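(* Let $w\in \mathrm{F}_d$ be a word, and consider its derived word $w'=[w(x_1,\dots,x_d),x_{d+1}]\in \mathrm{F}_{d+1}$. Let $\mathcal{M}$ be the family of sequences of probability measures that measure index uniformly. Then: (1) if $w$ satisfies a gap with respect to $\mathcal{M}$, then $w'$ satisfies a gap with respect to $\mathcal{M}$; (2) if $w$ satisfies a positivity result with respect to $\mathcal{M}$, then $w'$ satisfies a positivity result with respect to $\mathcal{M}$.
   Context: A word is a nontrivial element $w$ of the free group $\mathrm{F}_d$ on $x_1,\dots,x_d$; it defines a map $w:G^d\to G$ for every group $G$, and $G$ satisfies $w$ if $w(g_1,\dots,g_d)=1$ for all $g_i\in G$. For a sequence $M=\{\mu_n\}$ of probability measures on $G$, $\Pr_M(w=1\text{ on }G)=\limsup_{n\to\infty}\mu_n^{\times d}(\{(g_1,\dots,g_d)\in G^d: w(g_1,\dots,g_d)=1\})$. The sequence $M$ measures index uniformly if $\mu_n(xH)\to 1/[G:H]$ (with $1/\infty=0$) as $n\to\infty$, uniformly over all $x\in G$ and all subgroups $H\le G$. $w$ satisfies a gap with respect to $\mathcal{M}$ if there is $\phi:\mathbb{N}\to(0,1)$ such that for every $r$, every $r$-generated group $G$ (i.e. generated by $r$ elements) and every sequence $M\in\mathcal{M}$ on $G$, if $\Pr_M(w=1\text{ on }G)>1-\phi(r)$ then $G$ satisfies $w$. $w$ satisfies a positivity result (positivity property) with respect to $\mathcal{M}$ if there is $\psi:(0,1)\times\mathbb{N}\to\mathbb{N}$ such that for every $\varepsilon\in(0,1)$, every $r$-generated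 group $G$ and every $M\in\mathcal{M}$ on $G$, if $\Pr_M(w=1\text{ on }G)\ge\varepsilon$ then $G$ has a subgroup of index $\le\psi(\varepsilon,r)$ which satisfies $w$. *)

(* Defs.v *)
From HB Require Import structures.
From mathcomp Require Import all_boot all_order all_algebra.
From mathcomp Require Import all_classical all_reals all_analysis.

Set Implicit Arguments.
Unset Strict Implicit.
Unset Printing Implicit Defensive.

Import Order.TTheory GRing.Theory Num.Theory.

Local Open Scope classical_set_scope.

(** * The free group, as the group of freely reduced words *)

(* [(i, false)] stands for the generator [x_i], [(i, true)] for its inverse. *)
Definition letter (d : nat) : Type := ('I_d * bool)%type.

Definition linv d (a : letter d) : letter d := (a.1, ~~ a.2).

Definition reduced d (s : seq (letter d)) : bool :=
  sorted (fun a b => b != linv a) s.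

Record free_group (d : nat) := FreeGroup {
  free_word :> seq (letter d);
  _ : reduced free_word
}.

HB.instance Definition _ d := [isSub for @free_word d].
HB.instance Definition _ d := [Choice of free_group d by <:].

Section FreeGroup.
Variable d : nat.
Implicit Types (a b : letter d) (s t u : seq (letter d)) (x y z : free_group d).

Definition push a s : seq (letter d) :=
  if s is b :: s' then if b == linv a then s' else a :: s else [:: a].

Definition word_mul s t : seq (letter d) := foldr push t s.

Definition word_inv s : seq (letter d) := rev (map (@linv d) s).

Lemma linvK : involutive (@linv d).
Proof. by case=> i e; rewrite /linv /= negbK. Qed.

Lemma linv_eq a b : (b == linv a) = (a == linv b).
Proof. by apply/eqP/eqP => ->; rewrite linvK. Qed.

Lemma reducedP x : reduced x.
Proof. by case: x. Qed.

Lemma reduced_push a s : reduced s -> reduced (push a s).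
Proof.
case: s => [//|b s] /= bs; case: ifPn => [_|ba]; first exact: path_sorted bs.
by rewrite /reduced /= ba.
Qed.

Lemma push_linvK a s : reduced s -> push a (push (linv a) s) = s.
Proof.
case: s => [|b s] /=; first by rewrite eqxx.
rewrite linvK; case: eqVneq => [->|_ _] /=; last by rewrite eqxx.
by case: s => [//|c s] /= /andP[/negbTE ->].
Qed.

Lemma reduced_mul s t : reduced t -> reduced (word_mul s t).
Proof. by move=> rt; elim: s => //= a s; exact: reduced_push. Qed.

Lemma word_mul_push a s t :
  reduced t -> word_mul (push a s) t = push a (word_mul s t).
Proof.
move=> rt; case: s => [//|b s] /=; case: eqVneq => [->|//].
by rewrite push_linvK// reduced_mul.
Qed.

Lemma word_mulA s t u :
  reduced u -> word_mul s (word_mul t u) = word_mul (word_mul s t) u.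
Proof. by move=> ru; elim: s => //= a s ->; rewrite word_mul_push. Qed.

Lemma word_mulr1 s : reduced s -> word_mul s [::] = s.
Proof.
elim: s => //= a s IH ras; rewrite IH; last exact: path_sorted ras.
by case: s ras {IH} => //= b s /andP[/negbTE ->].
Qed.

Lemma reduced_inv s : reduced s -> reduced (word_inv s).
Proof.
rewrite /reduced rev_sorted sorted_map; apply: sub_sorted => a b /=.
by rewrite linvK eq_sym => ba; apply: contra ba => /eqP ->.
Qed.

Lemma word_mulVs s : word_mul (word_inv s) s = [::].
Proof.
elim: s => //= a s IH.
by rewrite /word_inv /= rev_cons /word_mul foldr_rcons /= linvK eqxx.
Qed.

Lemma word_invK : involutive word_inv.
Proof.
by move=> s; rewrite /word_inv map_rev revK -map_comp map_id_in// => a _ /=;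
   rewrite linvK.
Qed.

Definition free_one : free_group d := @FreeGroup d [::] isT.
Definition free_mul x y := FreeGroup (reduced_mul x (reducedP y)).
Definition free_inv x := FreeGroup (reduced_inv (reducedP x)).

Let free_mulA : associative free_mul.
Proof. by move=> x y z; apply/val_inj/word_mulA/reducedP. Qed.
Let free_mul1g : left_id free_one free_mul.
Proof. by move=> x; exact/val_inj. Qed.
Let free_mulg1 : right_id free_one free_mul.
Proof. by move=> x; apply/val_inj/word_mulr1/reducedP. Qed.
Let free_mulVg : left_inverse free_one free_inv free_mul.
Proof. by move=> x; apply/val_inj/word_mulVs. Qed.
Let free_mulgV : right_inverse free_one free_inv free_mul.
Proof.
by move=> x; apply/val_inj; rewrite /= -{1}[free_word x]word_invK word_mulVs.
Qed.

HB.instance Definition _ := isGroup.Build (free_group d)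
  free_mulA free_mul1g free_mulg1 free_mulVg free_mulgV.

Definition free_gen (i : 'I_d) : free_group d :=
  @FreeGroup d [:: (i, false)] isT.

End FreeGroup.

(** * Word maps *)

Definition word_map d (w : free_group d) (G : groupType) (g : d.-tuple G) : G :=
  (\prod_(a <- free_word w) if a.2 then (tnth g a.1)^-1 else tnth g a.1)%g.

Definition derived_word d (w : free_group d) : free_group d.+1 :=
  [~ word_map w [tuple free_gen (widen_ord (leqnSn d) i) | i < d],
     free_gen ord_max]%g.

(** * Subgroups, index, generation *)

Definition is_subgroup (G : groupType) (H : set G) : Prop :=
  group_closed [in H].

Definition lcoset (G : groupType) (x : G) (H : set G) : set G :=
  [set (x * h)%g | h in H].

(* The cardinal of the set of left cosets, [+oo] if there are infinitely many. *)
Definition index (R : realType) (G : groupType) (H : set G) : \bar R :=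
  counting (range (fun x => lcoset x H)).

Definition generated_by (r : nat) (G : groupType) : Prop :=
  exists g : 'I_r -> G, smallest (@is_subgroup G) (range g) = [set: G].

Definition subgroup_satisfies d (w : free_group d) (G : groupType)
    (H : set G) : Prop :=
  forall g : d.-tuple G, (forall i, H (tnth g i)) -> word_map w g = 1%g.

Definition group_satisfies d (w : free_group d) (G : groupType) : Prop :=
  forall g : d.-tuple G, word_map w g = 1%g.

(** * Probability measures on a group and their powers *)

(* The carrier of [G] with the sigma-algebra of all its subsets; only finitely
   generated, hence countable, groups are considered below. *)
Definition discrete (G : groupType) : Type := G.

HB.instance Definition _ (G : groupType) := Choice.on (discrete G).
HB.instance Definition _ (G : groupType) := isPointed.Build (discrete G) 1%g.
HB.instance Definition _ (G : groupType) :=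
  @isMeasurable.Build default_measure_display (discrete G)
    discrete_measurable discrete_measurable0
    discrete_measurableC discrete_measurableU.

Definition cons_pair (T : Type) n (p : T * n.-tuple T) : n.+1.-tuple T :=
  [tuple of p.1 :: p.2].

Section ConsPair.
Context d (T : measurableType d) (n : nat).

Let measurable_cons_pair : measurable_fun [set: T * n.-tuple T] (@cons_pair T n).
Proof. by apply: measurable_cons; [exact: measurable_fst|exact: measurable_snd]. Qed.

HB.instance Definition _ :=
  isMeasurableFun.Build _ _ _ _ (@cons_pair T n) measurable_cons_pair.

End ConsPair.

(* The [n]-fold product of [mu] with itself, transported from
   [T * (T * ...)] to [n.-tuple T]. *)
Fixpoint power_measure d (T : measurableType d) (R : realType)
    (mu : probability T R) (n : nat) : probability (n.-tuple T) R :=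
  if n is n'.+1 then
    distribution (mu \x power_measure mu n')%E (@cons_pair T n')
  else dirac [tuple].

Definition prob_seq (R : realType) (G : groupType) : Type :=
  nat -> probability (discrete G) R.

Definition prob_satisfies (R : realType) d (w : free_group d) (G : groupType)
    (M : prob_seq R G) : \bar R :=
  limn_esup (fun n =>
    power_measure (M n) d [set g : d.-tuple G | word_map w g = 1%g]).

(* In [\bar R] one has [(+oo)^-1 = 0]. *)
Definition measures_index_uniformly (R : realType) (G : groupType)
    (M : prob_seq R G) : Prop :=
  forall e : R, (0 < e)%R -> \forall n \near \oo,
    forall (x : G) (H : set G), is_subgroup H ->
      (`| M n (lcoset x H) - (index R H)^-1 | < e%:E)%E.

(** * Gap and positivity, for a family of sequences of measures on groups *)

Definition satisfies_gap (R : realType)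
    (MM : forall G : groupType, prob_seq R G -> Prop)
    d (w : free_group d) : Prop :=
  exists phi : nat -> R,
    (forall r, (0 < phi r < 1)%R) /\
    forall (r : nat) (G : groupType), generated_by r G ->
    forall M : prob_seq R G, MM G M ->
      ((1 - phi r)%:E < prob_satisfies w M)%E -> group_satisfies w G.

(* Only the values of [psi] at [0 < eps < 1] are relevant. *)
Definition satisfies_positivity (R : realType)
    (MM : forall G : groupType, prob_seq R G -> Prop)
    d (w : free_group d) : Prop :=
  exists psi : R -> nat -> nat,
    forall (eps : R), (0 < eps < 1)%R ->
    forall (r : nat) (G : groupType), generated_by r G ->
    forall M : prob_seq R G, MM G M ->
      (eps%:E <= prob_satisfies w M)%E ->
      exists H : set G, [/\ is_subgroup H,
        (index R H <= (psi eps r)%:R%:E)%E & subgroup_satisfies w H].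

(* Main.v *)
From HB Require Import structures.
From mathcomp Require Import all_boot all_order all_algebra.
From mathcomp Require Import generic_quotient lra.
From mathcomp Require Import all_classical all_reals all_analysis.
Require Import Defs.

(** Fix the first [d] arguments [g]. The last argument [x] satisfies
    [w'(g, x) = 1] exactly when [x] commutes with [w(g)], so the probability
    that [w' = 1] is the mean over [g] of the mass of the subgroup of elements
    commuting with [w(g)], and this mass is close to the inverse of the index
    of that subgroup, uniformly in [g].

    Let [N] be the intersection of the kernels of all actions of [G] on [k]
    points. A subgroup of index at most [k] contains [N], since [G] acts on its
    cosets ([index_le_action_kernel]). Hence if [w(g)] does not centralize [N],
    then the subgroup of elements commuting with [w(g)] has index at least
    [k + 1], and its mass is at most [dl = 1 / (k + 1) + e] for a small [e].
    Writing [Q] for the quotient of [G] by the centralizer of [N], this gives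

      Pr (w' = 1 on G) <= dl + (1 - dl) Pr (w = 1 on Q)

    where [Q] carries the image measures, which still measure index uniformly
    ([power_measure_derived_le], [image_measures_index_uniformly]). If [w' = 1]
    is likely on [G], then [w = 1] is likely on [Q], to which the hypothesis on
    [w] applies. If [H] is a subgroup of [Q] satisfying [w], then values of [w]
    on the preimage of [H] centralize [N], so the intersection of that preimage
    with [N] satisfies [w'] ([derived_word_satisfied]).

    For the gap, take [k = 1]: then [N = G], [Q] is the quotient by the center,
    and [H = Q]. For positivity, take [k] of order [1 / eps]: an action of an
    [r]-generated group is determined by the images of the generators, so there
    are boundedly many actions on [k] points and the index of [N] is bounded in
    terms of [r] and [k] ([index_action_kernel]). *)

Set Implicit Arguments.
Unset Strict Implicit.
Unset Printing Implicit Defensive.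

Import Order.TTheory GRing.Theory Num.Theory.

Local Open Scope classical_set_scope.
Local Open Scope card_scope.
Local Open Scope group_scope.

(** * Subgroups and their index *)

Section Subgroup.
Context {G : groupType}.
Implicit Types (H K : set G) (x y : G).

Lemma subgroupP H : is_subgroup H <-> H 1 /\ forall x y, H x -> H y -> H (x * y^-1).
Proof.
have inE' z : (z \in [in H]) = (z \in H) by [].
split => -[H1 HD]; split; rewrite ?inE'.
- by move: H1; rewrite inE' => /set_mem.
- move=> x y /mem_set Hx /mem_set Hy.
  by have := HD x y Hx Hy; rewrite inE' => /set_mem.
- exact: mem_set.
- by move=> x y; rewrite !inE' => /set_mem Hx /set_mem Hy; apply/mem_set/HD.
Qed.

Lemma subgroup1 H : is_subgroup H -> H 1.
Proof. by case/subgroupP. Qed.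

Lemma subgroupV H x : is_subgroup H -> H x -> H x^-1.
Proof. by case/subgroupP => H1 HD Hx; rewrite -div1g; exact: HD. Qed.

Lemma subgroupM H x y : is_subgroup H -> H x -> H y -> H (x * y).
Proof.
move=> sH Hx Hy; rewrite -[y]invgK; case/subgroupP: (sH) => _; apply => //.
exact: subgroupV.
Qed.

Lemma subgroupI H K : is_subgroup H -> is_subgroup K -> is_subgroup (H `&` K).
Proof.
move=> /subgroupP[H1 HD] /subgroupP[K1 KD]; apply/subgroupP; split => // x y.
by move=> [Hx Kx] [Hy Ky]; split; [exact: HD|exact: KD].
Qed.

Lemma eq_lcosetP H x y :
  is_subgroup H -> lcoset x H = lcoset y H <-> H (x^-1 * y).
Proof.
move=> sH; split=> [xy|Hxy].
  have : lcoset y H y by exists 1; [exact: subgroup1|rewrite mulg1].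
  by rewrite -xy => -[h Hh <-]; rewrite mulKg.
apply/seteqP; split=> _ [h Hh <-].
  exists ((x^-1 * y)^-1 * h); last by rewrite invgM invgK !mulgA mulgV mul1g.
  by apply: subgroupM => //; exact: subgroupV.
by exists (x^-1 * y * h); [exact: subgroupM|rewrite -mulgA mulVKg].
Qed.

End Subgroup.

Section Counting.
Context {R : realType}.

Lemma counting_le (T : choiceType) (A : set T) k :
  (counting A <= k%:R%:E :> \bar R)%E <-> A #<= `I_k.
Proof.
rewrite /counting; case: asboolP => [finA|infA]; last first.
  by split => // /card_le_finite /(_ (finite_II k)).
rewrite lee_fin ler_nat; split; last exact: geq_card_fset_set.
have /finite_setP[n An] := finA.
by rewrite (card_fset_set An) -card_le_II -(card_le_eql An).
Qed.

Lemma counting_ge (T : choiceType) (A : set T) k :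
  ~ (A #<= `I_k) -> (k.+1%:R%:E <= counting A :> \bar R)%E.
Proof.
rewrite /counting; case: asboolP => [finA|infA] Ak; last by rewrite leey.
rewrite lee_fin ler_nat ltnNge; apply/negP => Ak'; apply: Ak.
have /finite_setP[n An] := finA.
by move: Ak'; rewrite (card_fset_set An) -card_le_II -(card_le_eql An).
Qed.

Lemma card_eq_counting (T U : choiceType) (A : set T) (B : set U) :
  A #= B -> counting A = counting B :> \bar R.
Proof.
move=> AB; rewrite /counting (eq_finite_set AB); case: asboolP => // finB.
have finA : finite_set A by rewrite (eq_finite_set AB).
by congr (_%:R%:E); apply/fcard_eq.
Qed.

End Counting.

Section Index.
Context {R : realType} {G : groupType}.
Implicit Types (H K : set G) (x y : G).

(** A map into a finite type whose fibres lie in single cosets bounds the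
    index; all upper bounds below are obtained by exhibiting such a map. *)
Lemma index_le_card H (T : finType) (f : G -> T) : is_subgroup H ->
  (forall x y, f x = f y -> H (x^-1 * y)) -> (index R H <= #|T|%:R%:E)%E.
Proof.
move=> sH fH; apply/counting_le.
pose h t := lcoset (xget 1 [set x | f x = t]) H.
have -> : range (fun x => lcoset x H) = h @` range f.
  rewrite image_comp; apply: eq_imagel => x _ /=.
  apply/eq_lcosetP => //; apply: fH => /=.
  by case: xgetP => [y _ ->//|/(_ x)/(_ erefl)].
apply: card_le_trans (card_image_le _ _) _.
apply: card_le_trans (subset_card_le (@subsetT _ _)) _.
rewrite (card_le_eqr card_II).
rewrite -(card_le_eql (inj_card_eq (in2W (@enum_rank_inj T)))).
exact: subset_card_le.
Qed.

(** Conversely, an upper bound on the index labels the cosets by distinct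
    numbers below that bound. *)
Lemma index_le_inj H k : is_subgroup H -> (index R H <= k%:R%:E)%E ->
  exists f : G -> 'I_k, forall x y, f x = f y <-> H (x^-1 * y).
Proof.
move=> sH /counting_le/pcard_leP[g].
have gk x : (g (lcoset x H) < k)%N by have := @funS _ _ _ _ g; apply; exists x.
exists (fun x => Ordinal (gk x)) => x y; rewrite -eq_lcosetP//; split => [[]|xy].
  by apply: (@inj _ _ _ g); rewrite inE/=; [exists x|exists y].
by apply: val_inj => /=; rewrite xy.
Qed.

Lemma index_ge H k : ~ (index R H <= k%:R%:E)%E -> (k.+1%:R%:E <= index R H)%E.
Proof. by move=> Hk; apply/counting_ge => /counting_le. Qed.

(** The index is an integer or infinite, so failing to be at most [k] makes it
    at least [k + 1]. *)
Lemma inv_index_le H k : ~ (index R H <= k%:R%:E)%E ->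
  ((index R H)^-1 <= (k.+1%:R^-1)%:E)%E.
Proof.
move/index_ge; case: (index R H) => [r|_|//].
  rewrite lee_fin => kr; have r0 : (0 < r)%R by rewrite (lt_le_trans _ kr).
  by rewrite inver gt_eqF// lee_fin lef_pV2// posrE.
by rewrite invey lee_fin invr_ge0.
Qed.

Lemma index_setI_le H K m n : is_subgroup H -> is_subgroup K ->
  (index R H <= m%:R%:E -> index R K <= n%:R%:E ->
   index R (H `&` K) <= (m * n)%:R%:E)%E.
Proof.
move=> sH sK /index_le_inj-/(_ sH)[f fH] /index_le_inj-/(_ sK)[g gK].
rewrite -[m]card_ord -[n]card_ord -card_prod.
apply: (@index_le_card _ _ (fun x => (f x, g x))); first exact: subgroupI.
by move=> x y [/fH ? /gK ?].
Qed.

End Index.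

(** * Actions of a finitely generated group on finitely many points *)

Section Generation.
Context {G : groupType}.

Lemma generated_ind r (g : 'I_r -> G) (S : set G) :
  smallest (@is_subgroup G) (range g) = [set: G] ->
  is_subgroup S -> (forall i, S (g i)) -> forall x, S x.
Proof.
move=> gG sS gS x; have : [set: G] x by [].
by rewrite -gG; apply; split => // _ [i _ <-].
Qed.

End Generation.

Section Action.
Context {G : groupType}.
Implicit Types (H : set G) (x y : G).

Definition group_action (T : Type) (a : G -> T -> T) : Prop :=
  (forall i, a 1 i = i) /\ forall x y i, a (x * y) i = a x (a y i).

Lemma group_actionK (T : Type) (a : G -> T -> T) x : group_action a ->
  cancel (a x) (a x^-1).
Proof. by move=> [a1 aM] i; rewrite -aM mulVg a1. Qed.

Lemma group_actionKV (T : Type) (a : G -> T -> T) x : group_action a ->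
  cancel (a x^-1) (a x).
Proof. by move=> [a1 aM] i; rewrite -aM mulgV a1. Qed.

(** Plays the role of the intersection of all subgroups of index at most [k]:
    quantifying over actions instead makes it visibly normal and allows its
    cosets to be counted. *)
Definition action_kernel (k : nat) : set G :=
  [set x | forall a : G -> 'I_k -> 'I_k, group_action a -> a x =1 id].

Lemma action_kernel_subgroup k : is_subgroup (action_kernel k).
Proof.
apply/subgroupP; split => [a [a1 _]//|x y Nx Ny a aP i].
by case: (aP) => _ ->; rewrite Nx//= -{1}[i](Ny a aP) group_actionK.
Qed.

Lemma action_kernel_conj k x y : action_kernel k x -> action_kernel k (x ^ y).
Proof.
move=> Nx a aP i; case: (aP) => a1 aM.
by rewrite conjgE !aM Nx//= group_actionK.
Qed.

(** [G] acts on the at most [k] cosets of [H], and an element acting trivially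
    fixes the coset of [1], that is, lies in [H]. *)
Lemma index_le_action_kernel (R : realType) H k : is_subgroup H ->
  (index R H <= k%:R%:E)%E -> action_kernel k `<=` H.
Proof.
move=> sH /index_le_inj-/(_ sH)[f fH] x Nx.
(* [f] labels the cosets by numbers below [k]; [a] is the translation action on
   the labels in use and fixes the other numbers. *)
have fM z y y' : f y = f y' -> f (z * y) = f (z * y').
  by move=> /fH yy'; apply/fH; rewrite invgM -mulgA mulKg.
pose a z i :=
  if pselect (exists y, f y = i) is left e then f (z * sval (cid e)) else i.
have aE z y : a z (f y) = f (z * y).
  rewrite /a; case: pselect => [e|[]]; last by exists y.
  by apply: fM; case: cid.
have aN z i : ~ (exists y, f y = i) -> a z i = i by rewrite /a; case: pselect.
have aP : group_action a.
  split=> [i|z y i]; have [[u <-]|iN] := pselect (exists u, f u = i).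
  - by rewrite aE mul1g.
  - exact: aN.
  - by rewrite !aE mulgA.
  - by rewrite !aN.
have := Nx a aP (f 1); rewrite aE mulg1 /= => /esym/fH.
by rewrite invg1 mul1g.
Qed.

Lemma action_ext r (g : 'I_r -> G) (T : Type) (a b : G -> T -> T) :
  smallest (@is_subgroup G) (range g) = [set: G] ->
  group_action a -> group_action b ->
  (forall j, a (g j) =1 b (g j)) -> forall x, a x =1 b x.
Proof.
move=> gG aP bP ab; apply: (generated_ind (S := [set x | a x =1 b x]) gG) => //.
case: (aP) (bP) => a1 aM [b1 bM].
apply/subgroupP; split => [i|x y /= abx aby i]; first by rewrite a1 b1.
rewrite aM bM abx; congr (b x _).
by rewrite -{1}[i](group_actionKV y bP) -aby group_actionK.
Qed.

(** By [action_ext] an action on [k] points is determined by the table of values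
    of the generators, so the coset of [x] is determined by recording, for each
    table, the map by which [x] acts in the corresponding action. This bound
    depends on [r] and [k] only. *)
Lemma index_action_kernel (R : realType) r k : generated_by r G ->
  (index R (action_kernel k) <=
   #|{: {ffun {ffun 'I_r * 'I_k -> 'I_k} -> {ffun 'I_k -> 'I_k}}}|%:R%:E)%E.
Proof.
move=> [g gG].
pose spec (t : {ffun 'I_r * 'I_k -> 'I_k}) : set (G -> 'I_k -> 'I_k) :=
  [set a | group_action a /\ forall j i, a (g j) i = t (j, i)].
pose act t : G -> 'I_k -> 'I_k :=
  if pselect (exists a, spec t a) is left e then sval (cid e) else fun _ => id.
pose f x := [ffun t => [ffun i => act t x i]]
  : {ffun {ffun 'I_r * 'I_k -> 'I_k} -> {ffun 'I_k -> 'I_k}}.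
apply: (index_le_card (f := f)); first exact: action_kernel_subgroup.
move=> x y fxy a aP i; pose t : {ffun _ -> _} := [ffun p => a (g p.1) p.2].
have [bP bt] : spec t (act t).
  rewrite /act; case: pselect => [e|[]]; first by case: cid.
  by exists a; split => // j i0; rewrite ffunE.
have ab z : a z =1 act t z.
  by apply: (action_ext gG) => // j i0; rewrite bt ffunE.
have abxy : a x i = a y i.
  have := congr1 (fun h : {ffun _ -> {ffun _ -> _}} => h t i) fxy.
  by rewrite !ffunE -!ab.
by case: (aP) => _ aM; rewrite aM -abxy group_actionK.
Qed.

End Action.

(** * Morphisms and word maps *)

Section Morphism.
Context {G Q : groupType} (p : G -> Q).
Hypothesis pM : {morph p : x y / x * y}.

Lemma morph_one : p 1 = 1.
Proof. by apply: (mulgI (p 1)); rewrite -pM !mulg1. Qed.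

Lemma morph_inv x : p x^-1 = (p x)^-1.
Proof. by apply: (mulgI (p x)); rewrite -pM !mulgV morph_one. Qed.

Lemma morph_comm x y : p [~ x, y] = [~ p x, p y].
Proof. by rewrite /commg /conjg !(pM, morph_inv). Qed.

Lemma preimage_subgroup (H : set Q) : is_subgroup H -> is_subgroup (p @^-1` H).
Proof.
move=> /subgroupP[H1 HD]; apply/subgroupP; split; first by rewrite /= morph_one.
by move=> x y Hx Hy; rewrite /= pM morph_inv; exact: HD.
Qed.

Lemma morph_word_map d (w : free_group d) (g : d.-tuple G) :
  p (word_map w g) = word_map w (map_tuple p g).
Proof.
rewrite /word_map (big_morph p pM morph_one); apply: eq_bigr => a _.
by rewrite !tnth_map; case: a.2 => //; rewrite morph_inv.
Qed.

End Morphism.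

Section Surjection.
Context {G Q : groupType} (p : G -> Q).
Hypothesis pM : {morph p : x y / x * y}.
Hypothesis p_surj : forall z, exists x, p x = z.

Lemma preimage_lcoset (H : set Q) x :
  p @^-1` (lcoset (p x) H) = lcoset x (p @^-1` H).
Proof.
apply/seteqP; split=> [y [h Hh xh]|_ [h Hh <-]]; last by exists (p h).
by exists (x^-1 * y); rewrite ?mulVKg//= pM (morph_inv pM) -xh mulKg.
Qed.

Lemma index_preimage (R : realType) (H : set Q) :
  index R (p @^-1` H) = index R H.
Proof.
apply: card_eq_counting.
have -> : range (fun x => lcoset x (p @^-1` H)) =
          preimage p @` range (fun z => lcoset z H).
  rewrite image_comp; apply/seteqP; split=> _ [x _ <-] /=.
    by exists (p x) => //=; rewrite preimage_lcoset.
  by have [y <-] := p_surj x; exists y => //; rewrite preimage_lcoset.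
apply: inj_card_eq => A B _ _ AB; apply/seteqP; split=> z; have [x <-] := p_surj z.
  by rewrite -[A _]/((p @^-1` A) x) AB.
by rewrite -[B _]/((p @^-1` B) x) -AB.
Qed.

Lemma generated_by_image r : generated_by r G -> generated_by r Q.
Proof.
move=> [g gG]; exists (p \o g); apply/seteqP; split => // z _ H [sH gH].
have [x <-] := p_surj z.
apply: (generated_ind gG (preimage_subgroup pM sH)) => i.
by apply: gH; exists i.
Qed.

End Surjection.

Section FreeGroupHom.
Context {G : groupType} {d : nat} (g : d.-tuple G).

Let eval_letter (a : letter d) : G :=
  if a.2 then (tnth g a.1)^-1 else tnth g a.1.
Let eval (s : seq (letter d)) : G := \prod_(a <- s) eval_letter a.

(** Cancelling a letter against its inverse does not change the product of the
    values of the letters. *)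
Lemma word_mapM : {morph (fun w : free_group d => word_map w g) : x y / x * y}.
Proof.
have push_eval a s : eval (push a s) = eval_letter a * eval s.
  rewrite /eval; case: s => [|b s] /=; first by rewrite !(big_cons, big_nil).
  case: eqVneq => [->|_]; last by rewrite big_cons.
  rewrite big_cons mulgA [eval_letter (linv a)]/eval_letter /= /eval_letter.
  by case: a.2; rewrite /= ?mulVg ?mulgV mul1g.
move=> x y; rewrite /word_map /= -!/(eval _).
elim: (free_word x) => [|a s IH] /=; first by rewrite [eval [::]]big_nil mul1g.
by rewrite push_eval IH mulgA; congr (_ * _); rewrite /eval big_cons.
Qed.

Lemma word_map_gen i : word_map (free_gen i) g = tnth g i.
Proof. by rewrite /word_map /= big_seq1. Qed.

End FreeGroupHom.

Lemma word_map_derived d (w : free_group d) (G : groupType) (g : d.+1.-tuple G) :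
  word_map (derived_word w) g =
  [~ word_map w [tuple tnth g (widen_ord (leqnSn d) i) | i < d], tnth g ord_max].
Proof.
rewrite /derived_word (morph_comm (word_mapM g)) word_map_gen.
rewrite (morph_word_map (word_mapM g)); congr [~ word_map w _, _].
by apply: eq_from_tnth => i; rewrite !tnth_map !tnth_ord_tuple word_map_gen.
Qed.

Lemma word_map_derived_rcons d (w : free_group d) (G : groupType)
    (t : d.-tuple G) (x : G) :
  word_map (derived_word w) [tuple of rcons t x] = [~ word_map w t, x].
Proof.
rewrite word_map_derived; congr [~ word_map w _, _].
  apply: eq_from_tnth => i; rewrite tnth_map tnth_ord_tuple.
  by rewrite !(tnth_nth x) /= nth_rcons size_tuple ltn_ord.
by rewrite (tnth_nth x) /= nth_rcons size_tuple ltnn eqxx.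
Qed.

(** * Centralizers and quotients *)

Section Centralizer.
Context {G : groupType}.
Implicit Types (N : set G) (x y : G).

Definition normal_subgroup N : Prop :=
  is_subgroup N /\ forall x y, N x -> N (x ^ y).

Definition centralizer N : set G := [set x | forall y, N y -> [~ x, y] = 1].

Lemma centralizer_subgroup N : is_subgroup (centralizer N).
Proof.
apply/subgroupP; split => [y _|x x' Cx Cx' y Ny]; first by rewrite comm1g.
apply/eqP/commgP/commute_sym/commuteM; first exact/commute_sym/commgP/eqP/Cx.
exact/commuteV/commute_sym/commgP/eqP/Cx'.
Qed.

Lemma centralizer_normal N : normal_subgroup N -> normal_subgroup (centralizer N).
Proof.
move=> [sN NJ]; split=> [|x y Cx z Nz]; first exact: centralizer_subgroup.
by rewrite -[z](conjgKV y) -conjRg Cx ?conj1g//; exact: NJ.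
Qed.

End Centralizer.

Lemma action_kernel_normal (G : groupType) k :
  normal_subgroup (@action_kernel G k).
Proof.
by split=> [|x y]; [exact: action_kernel_subgroup|exact: action_kernel_conj].
Qed.

Section Quotient.
Context {G : groupType} {K : set G} (nK : normal_subgroup K).
Local Open Scope quotient_scope.

Let congruent : rel G := fun x y => `[< K (x^-1 * y) >].

Let congruentP x y : reflect (lcoset x K = lcoset y K) (congruent x y).
Proof.
by apply: (iffP (asboolP _)) => /eq_lcosetP; apply; case: nK.
Qed.

Let congruent_refl : reflexive congruent.
Proof. by move=> x; exact/congruentP. Qed.

Let congruent_sym : symmetric congruent.
Proof. by move=> x y; apply/congruentP/congruentP. Qed.

Let congruent_trans : transitive congruent.
Proof.
by move=> y x z /congruentP xy /congruentP yz; apply/congruentP; rewrite xy.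
Qed.

Let congruent_equiv :=
  EquivRel congruent congruent_refl congruent_sym congruent_trans.

Definition quotient_group : Type := {eq_quot congruent_equiv}.

HB.instance Definition _ := EqQuotient.on quotient_group.
HB.instance Definition _ := Choice.on quotient_group.

Let proj (x : G) : quotient_group := \pi_quotient_group x.

Let proj_eqP x y : proj x = proj y <-> K (x^-1 * y).
Proof.
by split => [/eqmodP/asboolP//|Kxy]; apply/eqmodP/asboolP.
Qed.

Let projK z : proj (repr z) = z.
Proof. exact: reprK. Qed.

Let one : quotient_group := proj 1.
Let mul (z z' : quotient_group) : quotient_group := proj (repr z * repr z').
Let inv (z : quotient_group) : quotient_group := proj (repr z)^-1.

Let projM x y : mul (proj x) (proj y) = proj (x * y).
Proof.
have [sK KJ] := nK; apply/proj_eqP.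
have /proj_eqP Kx := projK (proj x); have /proj_eqP Ky := projK (proj y).
have -> : (repr (proj x) * repr (proj y))^-1 * (x * y) =
    ((repr (proj x))^-1 * x) ^ repr (proj y) * ((repr (proj y))^-1 * y).
  by rewrite conjgE invgM !mulgA mulgK.
by apply: subgroupM => //; exact: KJ.
Qed.

Let projV x : inv (proj x) = proj x^-1.
Proof.
have [sK KJ] := nK; apply/proj_eqP; rewrite invgK.
have /proj_eqP Kx := projK (proj x).
have -> : repr (proj x) * x^-1 = (((repr (proj x))^-1 * x) ^ x^-1)^-1.
  by rewrite conjgE invgK !invgM !invgK !mulgA mulgV mul1g.
by apply: subgroupV => //; exact: KJ.
Qed.

Let mulA : associative mul.
Proof. by move=> x y z; rewrite -[x]projK -[y]projK -[z]projK !projM mulgA. Qed.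
Let mul1 : left_id one mul.
Proof. by move=> x; rewrite -[x]projK projM mul1g. Qed.
Let mulr1 : right_id one mul.
Proof. by move=> x; rewrite -[x]projK projM mulg1. Qed.
Let mulV : left_inverse one inv mul.
Proof. by move=> x; rewrite -[x]projK projV projM mulVg. Qed.
Let mulrV : right_inverse one inv mul.
Proof. by move=> x; rewrite -[x]projK projV projM mulgV. Qed.

HB.instance Definition _ := isGroup.Build quotient_group mulA mul1 mulr1 mulV mulrV.

(** Quotients enter the argument only through this: a measure on [G] can be
    pushed forward along [p], and [p u = 1] says that [u] is in [K]. *)
Lemma quotient_exists : exists (Q : groupType) (p : G -> Q),
  [/\ {morph p : x y / x * y}, forall z, exists x, p x = z &
      forall x, p x = 1 <-> K x].
Proof.
exists quotient_group, proj; split=> [x y|z|x].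
- by rewrite -projM.
- by exists (repr z); exact: projK.
- by split => [/esym/proj_eqP|Kx]; [|apply/esym/proj_eqP];
    rewrite invg1 mul1g.
Qed.

End Quotient.

(** * Powers of a measure on a discrete group *)

Section PowerMeasure.
Context {R : realType} {G : groupType}.
Implicit Types mu : probability (discrete G) R.
Local Open Scope ereal_scope.

Lemma measurable_discrete (A : set (discrete G)) : measurable A.
Proof. by []. Qed.

Lemma measurable_fun_discrete d (T : measurableType d) (f : discrete G -> T) :
  measurable_fun setT f.
Proof. by move=> _ B _; exact: measurable_discrete. Qed.

(** This is the definition of the product measure, so it holds for every set
    [A], measurable or not. Together with the measurability of all functions on
    [discrete G], it makes inductions on [n] free of measurability conditions,
    even though the powers of [discrete G] carry a product sigma-algebra. *)
Lemma power_measureS mu n (A : set (n.+1.-tuple G)) :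
  power_measure mu n.+1 A =
  \int[mu]_x power_measure mu n [set t | A (cons_pair (x, t))].
Proof.
rewrite /= /distribution /pushforward /product_measure1 /=.
apply: eq_integral => x _ /=; congr (power_measure mu n _).
by apply/seteqP; split => t; rewrite /xsection /= inE.
Qed.

(** Given the first [n] coordinates [t], the last one hits [A] with probability
    at most [1] if [t] is in [B], and at most [dl] otherwise. As the power
    measure is built by adding coordinates in front, the induction integrates
    out the first coordinate; the bound is affine in the mass of [B], hence
    stable under integration, and no exchange of integrals is needed. *)
Lemma power_measure_rcons_le mu (dl : R) n (A : set (n.+1.-tuple G))
    (B : set (n.-tuple G)) : (0 <= dl <= 1)%R ->
  (forall t, ~ B t -> mu [set x | A [tuple of rcons t x]] <= dl%:E) ->
  power_measure mu n.+1 A <= dl%:E + (1 - dl)%:E * power_measure mu n B.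
Proof.
move=> /andP[dl0 dl1]; have dl1' : (0 <= 1 - dl)%R by rewrite subr_ge0.
elim: n A B => [|n IH] A B AB; rewrite power_measureS.
  have -> : \int[mu]_x power_measure mu 0 [set t | A (cons_pair (x, t))] =
      mu [set x | A [tuple of rcons [tuple] x]].
    have -> : [set x | A [tuple of rcons [tuple] x]] =
              [set x | A (cons_pair (x, [tuple]))].
      by apply/funext => x /=; congr (A _); exact: val_inj.
    rewrite -(setIT [set x | _]) -integral_indic//.
  rewrite /= diracE; case: (boolP (_ \in B)) => [_|/negP BN].
    rewrite mule1 -EFinD addrC subrK; apply: probability_le1.
    exact: measurable_discrete.
  by rewrite mule0 adde0; apply: AB => Bt; apply: BN; rewrite inE.
rewrite power_measureS -[X in _ <= X + _]mule1 -(@probability_setT _ _ _ mu).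
rewrite -integral_cst// -ge0_integralZl// -ge0_integralD//; last first.
  by move=> x _; rewrite mule_ge0.
apply: ge0_le_integral => // x _.
apply: IH => t Bt; apply: le_trans (AB (cons_pair (x, t)) Bt).
rewrite le_eqVlt; apply/orP; left; apply/eqP; congr (mu _).
by apply/funext => y /=; congr (A _); exact: val_inj.
Qed.

End PowerMeasure.

Section ImageMeasure.
Context {R : realType} {G Q : groupType} (p : G -> Q).
Local Open Scope ereal_scope.

Definition discrete_map : discrete G -> discrete Q := p.

HB.instance Definition _ := isMeasurableFun.Build _ _ _ _ discrete_map
  (measurable_fun_discrete (T := discrete Q) discrete_map).

Definition image_measure (mu : probability (discrete G) R) :
    probability (discrete Q) R :=
  distribution mu discrete_map.

Lemma power_image_measure mu n (A : set (n.-tuple Q)) :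
  power_measure (image_measure mu) n A =
  power_measure mu n [set t | A (map_tuple p t)].
Proof.
elim: n A => [|n IH] A.
  rewrite /= !diracE; congr (_%:R%:E); congr nat_of_bool.
  by apply/idP/idP => /set_mem At; apply/mem_set; move: At => /=;
    congr (A _); exact: val_inj.
rewrite !power_measureS.
rewrite (@ge0_integral_pushforward _ _ _ _ _ discrete_map)//.
apply: eq_integral => x _ /=; rewrite IH; congr (power_measure mu n _).
by apply/funext => t /=; congr (A _); exact: val_inj.
Qed.

End ImageMeasure.

(** * Limits superior and measures on quotients *)

Section LimSup.
Context {R : realType}.
Implicit Types (u : (\bar R)^nat) (c : \bar R).
Local Open Scope ereal_scope.

Lemma limn_esup_lt_near u c :
  limn_esup u < c -> \forall n \near \oo, u n <= c.
Proof.
move=> /ereal_inf_lt[_ [V Voo <-] Vc]; apply: filterS Voo => n Vn.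
by apply: le_trans (ltW Vc); apply: ereal_sup_ubound; exists n.
Qed.

Lemma limn_esup_le_near u c :
  (\forall n \near \oo, u n <= c) -> limn_esup u <= c.
Proof.
move=> uc; apply: ge_ereal_inf; exists (ereal_sup (u @` [set n | u n <= c])).
  by exists [set n | u n <= c].
by apply: ge_ereal_sup => _ [n un <-].
Qed.

End LimSup.

(** Cosets in the image pull back to cosets of a subgroup of the same index, with
    the same mass. *)
Lemma image_measures_index_uniformly (R : realType) (G Q : groupType)
    (p : G -> Q) (M : prob_seq R G) :
  {morph p : x y / x * y} -> (forall z, exists x, p x = z) ->
  measures_index_uniformly M ->
  measures_index_uniformly (fun n => image_measure p (M n)).
Proof.
move=> pM p_surj MU e e0; apply: filterS (MU e e0) => n Mn z H sH.
have [x <-] := p_surj z; have sH' := preimage_subgroup pM sH.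
have := Mn x _ sH'; rewrite -(preimage_lcoset pM).
by rewrite (index_preimage pM p_surj).
Qed.

(** * The derived word *)

Section DerivedProbability.
Context {R : realType} {G : groupType}.
Local Open Scope ereal_scope.

Lemma commuting_subgroup (u : G) : is_subgroup [set x | [~ u, x] = 1%g].
Proof.
apply/subgroupP; split => [/=|x y /= /eqP/commgP ux /eqP/commgP uy].
  exact: commg1.
by apply/eqP/commgP/commuteM => //; exact: commuteV.
Qed.

(** If the subgroup of elements commuting with [u] had index at most [k], it would
    contain the kernel of all actions on [k] points, which [u] would centralize. *)
Lemma mass_commuting_le (mu : probability (discrete G) R) k (e : R) (u : G) :
  (forall H : set G, is_subgroup H ->
     `| mu (lcoset 1%g H) - (index R H)^-1 | < e%:E) ->
  ~ centralizer (action_kernel k) u ->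
  mu [set x | [~ u, x] = 1%g] <= (k.+1%:R^-1 + e)%:E.
Proof.
set C := [set x | _]; move=> muC uN.
have sC : is_subgroup C by exact: commuting_subgroup.
have Ck : (index R C)^-1 <= (k.+1%:R^-1)%:E.
  apply: inv_index_le => Ck; apply: uN => x Nx.
  exact: (index_le_action_kernel sC Ck).
have := muC _ sC; have -> : lcoset 1%g C = C.
  by apply/seteqP; split=> [_ [h Ch <-]|h Ch]; [|exists h]; rewrite ?mul1g.
move: Ck; case: (index R C)^-1 => [s|//|_].
  rewrite lee_fin => sk /ltW/(le_trans (lee_abs _)).
  by rewrite leeBlDr// -EFinD => /le_trans; apply; rewrite lee_fin addrC lerD2r.
(* The inverse index would be [-oo], at infinite distance from the finite mass. *)
by rewrite -[X in `|X - _|]fineK ?fin_num_measure.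
Qed.

(** For [derived_word w] to vanish, the last argument must commute with the value
    of [w] at the others, and that value is either killed by [p] or commutes with
    elements of total mass at most [1 / (k + 1) + e]. *)
Lemma power_measure_derived_le d (w : free_group d) (Q : groupType)
    (p : G -> Q) (mu : probability (discrete G) R) k (e : R) :
  {morph p : x y / (x * y)%g} ->
  (forall u, centralizer (action_kernel k) u -> p u = 1%g) ->
  (0 <= k.+1%:R^-1 + e <= 1)%R ->
  (forall H : set G, is_subgroup H ->
     `| mu (lcoset 1%g H) - (index R H)^-1 | < e%:E) ->
  power_measure mu d.+1 [set g : d.+1.-tuple G | word_map (derived_word w) g = 1%g]
  <= (k.+1%:R^-1 + e)%:E + (1 - (k.+1%:R^-1 + e))%:E *
     power_measure (image_measure p mu) d [set g | word_map w g = 1%g].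
Proof.
move=> pM pC dl01 muC; rewrite power_image_measure.
apply: power_measure_rcons_le => // t /= wt.
have -> : [set x | word_map (derived_word w) [tuple of rcons t x] = 1%g] =
          [set x | [~ word_map w t, x] = 1%g].
  by apply/funext => x /=; rewrite word_map_derived_rcons.
apply: mass_commuting_le muC _ => /pC; rewrite (morph_word_map pM).
exact: wt.
Qed.

(** Both bounds compare a limit superior with a constant, so it is enough that the
    terms eventually satisfy them; a strict bound on the limit superior for [w]
    yields an eventual one. *)
Lemma prob_derived_le d (w : free_group d) (Q : groupType) (p : G -> Q)
    (M : prob_seq R G) k (e c : R) :
  {morph p : x y / (x * y)%g} ->
  (forall u, centralizer (action_kernel k) u -> p u = 1%g) ->
  measures_index_uniformly M -> (0 < e)%R -> (k.+1%:R^-1 + e <= 1)%R ->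
  prob_satisfies w (fun n => image_measure p (M n)) < c%:E ->
  prob_satisfies (derived_word w) M <=
    (k.+1%:R^-1 + e + (1 - (k.+1%:R^-1 + e)) * c)%:E.
Proof.
move=> pM pC MU e0 dl1 /limn_esup_lt_near Pc; apply: limn_esup_le_near.
have dl0 : (0 <= k.+1%:R^-1 + e)%R by rewrite addr_ge0 ?invr_ge0 ?ltW.
apply: filterS2 Pc (MU e e0) => n Pc Mn.
apply: le_trans (power_measure_derived_le w (e := e) pM pC _ _) _.
  exact/andP.
  by move=> H; exact: Mn.
by rewrite [leRHS]EFinD leeD2l// EFinM lee_wpmul2l// lee_fin subr_ge0.
Qed.

End DerivedProbability.

Lemma derived_word_satisfied d (w : free_group d) (G Q : groupType) (p : G -> Q)
    (N : set G) (H : set Q) :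
  {morph p : x y / x * y} -> (forall u, p u = 1 -> centralizer N u) ->
  subgroup_satisfies w H ->
  subgroup_satisfies (derived_word w) (p @^-1` H `&` N).
Proof.
move=> pM pN wH g gHN; rewrite word_map_derived; apply: pN; last first.
  by have [] := gHN ord_max.
rewrite (morph_word_map pM); apply: wH => i.
by rewrite !tnth_map tnth_ord_tuple; have [] := gHN (widen_ord (leqnSn d) i).
Qed.

Lemma action_kernel1 (G : groupType) : @action_kernel G 1 = [set: G].
Proof. by apply/seteqP; split => // x _ a _ i; rewrite !ord1. Qed.

(** With [k = 1] and [e = 1/4] one has [dl = 3/4], so a defect of [phi r / 2] for
    [w] on the quotient becomes a defect of [phi r / 8] for the derived word. The
    factor [1/2] in [phi r / 2] provides the strict inequality between limits
    superior that [prob_derived_le] needs. *)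
Lemma derived_word_gap (R : realType) d (w : free_group d) :
  satisfies_gap (@measures_index_uniformly R) w ->
  satisfies_gap (@measures_index_uniformly R) (derived_word w).
Proof.
move=> [phi [phi01 gap]]; exists (fun r => phi r / 8)%R; split=> [r|r G gG M MU PM].
  by have /andP[? ?] := phi01 r; apply/andP; split; lra.
have [Q [p [pM p_surj pC]]] :=
  quotient_exists (centralizer_normal (@action_kernel_normal G 1)).
have QU := image_measures_index_uniformly pM p_surj MU.
have wQ : group_satisfies w Q.
  apply: (gap r Q (generated_by_image pM p_surj gG) _ QU).
  rewrite ltNge; apply/negP => Pw; move: PM; apply/negP; rewrite -leNgt.
  have /andP[phi0 phi1] := phi01 r.
  apply: le_trans (prob_derived_le (k := 1) (e := (1/4)%R) (c := (1 - phi r / 2)%R)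
    pM _ MU _ _ _) _.
  - by move=> u; rewrite pC.
  - by lra.
  - by lra.
  - by apply: le_lt_trans Pw _; rewrite lte_fin; lra.
  - by rewrite lee_fin; lra.
move=> g; apply: (derived_word_satisfied (p := p) (N := action_kernel 1)
  (H := [set: Q]) pM) => [u|t _|i]; rewrite ?pC//.
by rewrite action_kernel1.
Qed.

(** With [1 / (k + 1) <= eps / 4] and [e = eps / 4], a probability below
    [eps / 4] for [w] on the quotient would give one of at most [3 eps / 4] for
    the derived word. *)
Lemma derived_word_positivity (R : realType) d (w : free_group d) :
  satisfies_positivity (@measures_index_uniformly R) w ->
  satisfies_positivity (@measures_index_uniformly R) (derived_word w).
Proof.
move=> [psi pos].
pose k (eps : R) := Num.truncn (4 / eps)%R.
exists (fun eps r => psi (eps / 4)%R r *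
  #|{: {ffun {ffun 'I_r * 'I_(k eps) -> 'I_(k eps)} ->
         {ffun 'I_(k eps) -> 'I_(k eps)}}}|)%N.
move=> eps /andP[eps0 eps1] r G gG M MU PM.
have keps : ((k eps).+1%:R^-1 <= eps / 4)%R.
  rewrite -[leRHS]invrK lef_pV2 ?posrE ?invr_gt0 ?divr_gt0// invf_div.
  by rewrite ltW// truncnS_gt.
have [Q [p [pM p_surj pC]]] :=
  quotient_exists (centralizer_normal (@action_kernel_normal G (k eps))).
have QU := image_measures_index_uniformly pM p_surj MU.
have eps4 : (0 < eps / 4 < 1)%R by apply/andP; split; lra.
have [|H [sH indexH wH]] :=
    pos _ eps4 r Q (generated_by_image pM p_surj gG) _ QU.
  rewrite leNgt; apply/negP => Pw; move: PM; apply/negP; rewrite -ltNge.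
  have k0 : (0 < (k eps).+1%:R^-1 :> R)%R by rewrite invr_gt0.
  apply: le_lt_trans
    (prob_derived_le (k := k eps) (e := (eps / 4)%R) pM _ MU _ _ Pw) _.
  - by move=> u; rewrite pC.
  - by lra.
  - by move: (_.+1%:R^-1)%R k0 keps => c; lra.
  - rewrite lte_fin; move: (_.+1%:R^-1)%R k0 keps => c c0 c4.
    suff : (0 <= (c + eps / 4) * (eps / 4))%R by lra.
    by rewrite mulr_ge0//; lra.
exists (p @^-1` H `&` action_kernel (k eps)); split.
- by apply: subgroupI; [exact: preimage_subgroup|exact: action_kernel_subgroup].
- apply: index_setI_le; [exact: preimage_subgroup|exact: action_kernel_subgroup|..].
    by rewrite (index_preimage pM p_surj).
  exact: index_action_kernel.
- by apply: derived_word_satisfied => // u; rewrite pC.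
Qed.

Theorem theorem4p1 (R : realType) (d : nat) (w : free_group d)
    (hw : w <> 1%g) :
  (satisfies_gap (@measures_index_uniformly R) w ->
   satisfies_gap (@measures_index_uniformly R) (derived_word w)) /\
  (satisfies_positivity (@measures_index_uniformly R) w ->
   satisfies_positivity (@measures_index_uniformly R) (derived_word w)).
Proof. by split; [exact: derived_word_gap|exact: derived_word_positivity]. Qed.
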